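(* Suppose that Assumptions A and B (written out in the context) hold. Fix $\theta\in\Theta\setminus\Theta_0$ and assume that $\hat\theta_{\rm C}=O_{\rm P}(1)$ under ${\rm P}^{(n)}_\theta$. Then the preliminary test estimator $\hat\theta_{\rm PTE}=\mathbb{I}[\phi_n=1]\,\hat\theta_{\rm U}+\mathbb{I}[\phi_n=0]\,\hat\theta_{\rm C}$ satisfies $$\nu_n^{-1}(\hat\theta_{\rm PTE}-\theta)=\nu_n^{-1}(\hat\theta_{\rm U}-\theta)+o_{\rm P}(1)\quad\text{under }{\rm P}^{(n)}_\theta,\ \text{as } n\to\infty.$$
   Context: All limits are as $n\to\infty$. $\Theta\subset\mathbb{R}^p$ is open and $\{{\rm P}^{(n)}_\theta:\theta\in\Theta\}$ is, for each $n$, a parametric family of probability measures. The constraint set is $\Theta_0=\mathcal{M}(\Upsilon)\cap\Theta$, where $\Upsilon$ is a fixed $p\times r$ matrix of full rank $r<p$ and $\mathcal{M}(\Upsilon)$ is the linear span of its columns. $\mathbb{I}[A]$ is the indicator of $A$; a prime denotes transposition; $\|\cdot\|$ is the Euclidean norm. $\chi^2_{\ell,\beta}$ denotes the quantile of order $\beta$ of the $\chi^2_\ell$ distribution (the probability of being $\le\chi^2_{\ell,\beta}$ is $\beta$). The unconstrained estimator $\hat\theta_{\rm U}$ takes values in $\Theta$, the constrained estimator $\hat\theta_{\rm C}$ takes values in $\Theta_0$, and $\phi_n\in\{0,1\}$ is a test of $\mathcal{H}_0:\theta\in\Theta_0$ against $\mathcal{H}_1:\theta\notin\Theta_0$ ($\phi_n=1$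 meaning rejection); all are functions of the $n$th observation. Assumption A (ULAN). There exists a sequence $(\nu_n)$ of non-random full-rank $p\times p$ matrices with $\nu_n=o(1)$ such that, for every $\theta\in\Theta$, every sequence $(\theta_n)$ in $\Theta$ with $\nu_n^{-1}(\theta_n-\theta)=O(1)$ and every sequence $(\tau_n)$ in $\mathbb{R}^p$ with $\tau_n=O(1)$ and $\theta_n+\nu_n\tau_n\in\Theta$ for all $n$, $$\log\frac{d{\rm P}^{(n)}_{\theta_n+\nu_n\tau_n}}{d{\rm P}^{(n)}_{\theta_n}}=\tau_n'\Delta^{(n)}_{\theta_n}-\tfrac12\tau_n'\Gamma_\theta\tau_n+o_{\rm P}(1)$$ under ${\rm P}^{(n)}_\theta$, where the random $p$-vector $\Delta^{(n)}_\theta$ is, under ${\rm P}^{(n)}_\theta$, asymptotically normal with mean $0$ and covariance matrix $\Gamma_\theta$. Assumption B. With $\nu_n$ and $\Delta^{(n)}_\theta$ as in Assumption A, there exists a random $p$-vector $S^{(n)}_\theta$ such that, under ${\rm P}^{(n)}_\theta$, $(S^{(n)\prime}_\theta,\Delta^{(n)\prime}_\theta)'$ is asymptotically normal with mean $0$ and covariance matrix $\begin{pmatrix}\Sigma_\theta&\Omega_\theta\\ \Omega_\theta'&\Gamma_\theta\end{pmatrix}$ and such that, for some $p\times p$ matrix $A_\theta$ and $r\times p$ matrix $B_\theta$: (i) $\nu_n^{-1}(\hat\theta_{\rm U}-\theta)=A_\theta S^{(n)}_\theta+o_{\rm P}(1)$ under ${\rm P}^{(n)}_\theta$, for $\theta\in\Theta$;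 (ii) $\nu_n^{-1}(\hat\theta_{\rm C}-\theta)=\Upsilon B_\theta S^{(n)}_\theta+o_{\rm P}(1)$ under ${\rm P}^{(n)}_\theta$, for $\theta\in\Theta_0$; (iii) $\phi_n$ rejects $\mathcal{H}_0$ at asymptotic level $\alpha$ when $Q^{(n)}:=\|D^{(n)}\|^2>\chi^2_{p-r,1-\alpha}$ (that is, $\phi_n=\mathbb{I}[Q^{(n)}>\chi^2_{p-r,1-\alpha}]$), where $D^{(n)}$ is a random $p$-vector (a statistic) such that $D^{(n)}=C_\theta S^{(n)}_\theta+o_{\rm P}(1)$ under ${\rm P}^{(n)}_\theta$, $\theta\in\Theta_0$, for some $p\times p$ matrix $C_\theta$ satisfying $\Sigma_\theta C_\theta'C_\theta\Sigma_\theta C_\theta'C_\theta\Sigma_\theta=\Sigma_\theta C_\theta'C_\theta\Sigma_\theta$ and ${\rm tr}[C_\theta'C_\theta\Sigma_\theta]=p-r$. Furthermore, the probability of $Q^{(n)}>\chi^2_{p-r,1-\alpha}$ converges to one under ${\rm P}^{(n)}_\theta$ for every $\theta\in\Theta\setminus\Theta_0$. *)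

(* Defs.v *)
From HB Require Import structures.
From mathcomp Require Export all_boot all_order all_algebra.
From mathcomp Require Export all_classical all_reals all_analysis.
From mathcomp Require Export measurable_realfun.
Export Order.TTheory GRing.Theory Num.Theory numFieldNormedType.Exports.

Set Implicit Arguments.
Unset Strict Implicit.
Unset Printing Implicit Defensive.

Local Open Scope classical_set_scope.
Local Open Scope ring_scope.

(* The library's norm on matrices is the maximum norm. *)
Definition enorm (R : realType) (k : nat) (v : 'cV[R]_k) : R :=
  Num.sqrt (\sum_(i < k) v i 0 ^+ 2).

Definition dot (R : realType) (k : nat) (u v : 'cV[R]_k) : R := (u^T *m v) 0 0.

Definition quad_form (R : realType) (k : nat) (M : 'M[R]_k) (t : 'cV[R]_k) : R :=
  (t^T *m M *m t) 0 0.

(* Coordinatewise measurability is Borel measurability: the Borel sigma-algebra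
   of R^k is the product one. *)
Definition random_vector (R : realType) (d : measure_display)
    (T : measurableType d) (k : nat) (V : T -> 'cV[R]_k) : Prop :=
  forall i, measurable_fun setT (fun x => V x i 0).

(* In all sequence-indexed notions below, the n-th variable lives on its own
   space X n, equipped with Q n. *)

Definition cvg_in_prob0 (R : realType) (d : nat -> measure_display)
    (X : forall n, measurableType (d n)) (Q : forall n, probability (X n) R)
    (Y : forall n, X n -> \bar R) : Prop :=
  forall eps : R, 0 < eps ->
    Q n [set x | (eps%:E <= `|Y n x|)%E] @[n --> \oo] --> 0%E.

(* V = W + o_P(1) under Q *)
Definition eq_oP (R : realType) (d : nat -> measure_display)
    (X : forall n, measurableType (d n)) (Q : forall n, probability (X n) R)
    (k : nat) (V W : forall n, X n -> 'cV[R]_k) : Prop :=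
  cvg_in_prob0 Q (fun n x => (enorm (V n x - W n x))%:E).

(* V = O_P(1) under Q *)
Definition is_OP (R : realType) (d : nat -> measure_display)
    (X : forall n, measurableType (d n)) (Q : forall n, probability (X n) R)
    (k : nat) (V : forall n, X n -> 'cV[R]_k) : Prop :=
  forall eps : R, 0 < eps -> exists M : R,
    \forall n \near \oo, (Q n [set x | M < enorm (V n x)]%R <= eps%:E)%E.

(* The normal law with mean m and variance v >= 0. The library's
   normal_prob m 0 is not the Dirac mass at m. *)
Definition normal_law (R : realType) (m v : R) (A : set R) : \bar R :=
  if v == 0 then \d_m A else normal_prob m (Num.sqrt v) A.

(* Z has law N(0, Sigma), with Sigma possibly singular: every linear combination
   of the coordinates of Z is univariate normal. *)
Definition gaussian_vector (R : realType) (d : measure_display)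
    (T : measurableType d) (Q : probability T R) (k : nat)
    (Z : T -> 'cV[R]_k) (Sigma : 'M[R]_k) : Prop :=
  [/\ random_vector Z, Sigma^T = Sigma &
      forall t : 'cV[R]_k, 0 <= quad_form Sigma t /\
        forall A : set R, measurable A ->
          Q [set x | A (dot t (Z x))] = normal_law 0 (quad_form Sigma t) A].

Definition cvg_in_law (R : realType) (d : nat -> measure_display)
    (X : forall n, measurableType (d n)) (Q : forall n, probability (X n) R)
    (d' : measure_display) (T : measurableType d') (Q' : probability T R)
    (k : nat) (V : forall n, X n -> 'cV[R]_k) (Z : T -> 'cV[R]_k) : Prop :=
  forall f : 'cV[R]_k -> R, continuous f ->
    (exists M : R, forall v, `|f v| <= M) ->
    'E_(Q n)[f \o V n]%E @[n --> \oo] --> 'E_Q'[f \o Z]%E.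

Definition asymp_normal0 (R : realType) (d : nat -> measure_display)
    (X : forall n, measurableType (d n)) (Q : forall n, probability (X n) R)
    (k : nat) (V : forall n, X n -> 'cV[R]_k) (Sigma : 'M[R]_k) : Prop :=
  exists (d' : measure_display) (T : measurableType d') (Q' : probability T R)
    (Z : T -> 'cV[R]_k),
    gaussian_vector Q' Z Sigma /\ cvg_in_law Q Q' V Z.

(* L is a version of dQ1/dQ0, the density with respect to Q0 of the absolutely
   continuous part of Q1 in its Lebesgue decomposition; Q1 is not required to be
   dominated by Q0. The set N carries the singular part. *)
Definition is_likelihood_ratio (R : realType) (d : measure_display)
    (T : measurableType d) (Q1 Q0 : probability T R) (L : T -> \bar R) : Prop :=
  [/\ measurable_fun setT L, (forall x, (0 <= L x)%E) &
      exists N : set T, [/\ measurable N, Q0 N = 0%E &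
        forall A, measurable A ->
          Q1 A = (\int[Q0]_(x in A) L x + Q1 (A `&` N))%E]].

Definition Gamma_fun (R : realType) (s : R) : R :=
  \int[lebesgue_measure]_(t in `]0, +oo[) (t `^ (s - 1) * expR (- t)).

Definition chi2_pdf (R : realType) (l : nat) (x : R) : R :=
  if 0 < x then
    x `^ (l%:R / 2 - 1) * expR (- x / 2) / (2 `^ (l%:R / 2) * Gamma_fun (l%:R / 2))
  else 0.

Definition chi2_cdf (R : realType) (l : nat) (x : R) : \bar R :=
  (\int[lebesgue_measure]_(t in `]-oo, x]) (chi2_pdf l t)%:E)%E.

(* For 0 < l and 0 < b < 1 this is the unique x such that chi2_cdf l x = b. *)
Definition chi2_quantile (R : realType) (l : nat) (b : R) : R :=
  inf [set x | (b%:E <= chi2_cdf l x)%E].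

Definition col_span (R : realType) (p r : nat) (U : 'M[R]_(p, r)) :
    set 'cV[R]_p :=
  [set U *m u | u in setT].

Definition constraint_set (R : realType) (p r : nat) (U : 'M[R]_(p, r))
    (Theta : set 'cV[R]_p) : set 'cV[R]_p :=
  col_span U `&` Theta.

(* The likelihood expansion is required of every version of the likelihood
   ratio; lne is -oo where the ratio vanishes. *)
Record ULAN (R : realType) (p : nat) (Theta : set 'cV[R]_p)
    (d : nat -> measure_display) (X : forall n, measurableType (d n))
    (P : forall n, 'cV[R]_p -> probability (X n) R)
    (nu : nat -> 'M[R]_p)
    (Delta : forall n, 'cV[R]_p -> X n -> 'cV[R]_p)
    (Gamma : 'cV[R]_p -> 'M[R]_p) : Prop := {
  ulan_nu_full_rank : forall n, nu n \in unitmx ;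
  ulan_nu_o1 : nu n @[n --> \oo] --> (0 : 'M[R]_p) ;
  ulan_Delta_random : forall n theta, Theta theta -> random_vector (Delta n theta) ;
  ulan_expansion : forall theta, Theta theta ->
    forall thetan : nat -> 'cV[R]_p, (forall n, Theta (thetan n)) ->
    (fun n => invmx (nu n) *m (thetan n - theta)) =O_\oo (fun=> 1 : R) ->
    forall tau : nat -> 'cV[R]_p, tau =O_\oo (fun=> 1 : R) ->
    (forall n, Theta (thetan n + nu n *m tau n)) ->
    forall L : forall n, X n -> \bar R,
    (forall n, is_likelihood_ratio
       (P n (thetan n + nu n *m tau n)) (P n (thetan n)) (L n)) ->
    cvg_in_prob0 (fun n => P n theta) (fun n x =>
      lne (L n x) - (dot (tau n) (Delta n (thetan n) x)
                     - 2^-1 * quad_form (Gamma theta) (tau n))%:E)%E ;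
  ulan_Delta_normal : forall theta, Theta theta ->
    asymp_normal0 (fun n => P n theta) (fun n => Delta n theta) (Gamma theta) }.

Record estimators_and_test (R : realType) (p r : nat) (Theta : set 'cV[R]_p)
    (Upsilon : 'M[R]_(p, r))
    (d : nat -> measure_display) (X : forall n, measurableType (d n))
    (P : forall n, 'cV[R]_p -> probability (X n) R)
    (nu : nat -> 'M[R]_p)
    (Delta : forall n, 'cV[R]_p -> X n -> 'cV[R]_p)
    (Gamma : 'cV[R]_p -> 'M[R]_p)
    (thetaU thetaC : forall n, X n -> 'cV[R]_p)
    (phi : forall n, X n -> bool) (alpha : R)
    (S : forall n, 'cV[R]_p -> X n -> 'cV[R]_p)
    (Sigma Omega : 'cV[R]_p -> 'M[R]_p)
    (A : 'cV[R]_p -> 'M[R]_p) (B : 'cV[R]_p -> 'M[R]_(r, p))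
    (C : 'cV[R]_p -> 'M[R]_p)
    (D : forall n, X n -> 'cV[R]_p) : Prop := {
  et_S_random : forall n theta, Theta theta -> random_vector (S n theta) ;
  et_joint_normal : forall theta, Theta theta ->
    asymp_normal0 (fun n => P n theta)
      (fun n x => col_mx (S n theta x) (Delta n theta x))
      (block_mx (Sigma theta) (Omega theta) (Omega theta)^T (Gamma theta)) ;
  et_unconstrained : forall theta, Theta theta ->
    eq_oP (fun n => P n theta)
      (fun n x => invmx (nu n) *m (thetaU n x - theta))
      (fun n x => A theta *m S n theta x) ;
  et_constrained : forall theta, constraint_set Upsilon Theta theta ->
    eq_oP (fun n => P n theta)
      (fun n x => invmx (nu n) *m (thetaC n x - theta))
      (fun n x => Upsilon *m B theta *m S n theta x) ;
  et_D_random : forall n, random_vector (D n) ;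
  et_test : forall n x,
    phi n x = (chi2_quantile (p - r) (1 - alpha) < enorm (D n x) ^+ 2) ;
  et_level : forall theta, constraint_set Upsilon Theta theta ->
    (limn_esup (fun n => P n theta [set x | phi n x]) <= alpha%:E)%E ;
  et_D : forall theta, constraint_set Upsilon Theta theta ->
    eq_oP (fun n => P n theta) D (fun n x => C theta *m S n theta x) ;
  et_C_idempotent : forall theta, constraint_set Upsilon Theta theta ->
    Sigma theta *m (C theta)^T *m C theta *m Sigma theta
      *m (C theta)^T *m C theta *m Sigma theta
    = Sigma theta *m (C theta)^T *m C theta *m Sigma theta ;
  et_C_trace : forall theta, constraint_set Upsilon Theta theta ->
    \tr ((C theta)^T *m C theta *m Sigma theta) = (p - r)%:R ;
  et_consistent : forall theta, (Theta `\` constraint_set Upsilon Theta) theta ->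
    P n theta [set x | chi2_quantile (p - r) (1 - alpha) < enorm (D n x) ^+ 2]
      @[n --> \oo] --> 1%E }.

Definition pte (R : realType) (p : nat) (d : nat -> measure_display)
    (X : forall n, measurableType (d n))
    (phi : forall n, X n -> bool) (thetaU thetaC : forall n, X n -> 'cV[R]_p)
    (n : nat) (x : X n) : 'cV[R]_p :=
  (phi n x == true)%:R *: thetaU n x + (phi n x == false)%:R *: thetaC n x.

(* Main.v *)
Require Import Defs.

(** On the event that the test rejects, the preliminary test estimator is the
    unconstrained estimator, so the two rescaled errors coincide there. Off the
    constraint set the test is consistent, so the probability of that event
    tends to one ([et_consistent]), and two sequences of random vectors that agree with
    probability tending to one differ by an o_P(1) ([eq_oP_of_eq_on]). The
    difference is exactly zero on the rejection event, hence the factor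
    [invmx (nu n)], which diverges, does no harm.

    The remaining work is measurability: the value of a measure on a
    non-measurable set is not controlled, so the comparison of probabilities
    needs the deviation event to be measurable. *)

Local Open Scope classical_set_scope.
Local Open Scope ring_scope.

Lemma enorm0 (R : realType) (k : nat) : enorm (0 : 'cV[R]_k) = 0.
Proof.
by rewrite /enorm big1 ?sqrtr0 // => i _; rewrite mxE expr0n.
Qed.

Lemma measurable_enorm (R : realType) (d : measure_display)
    (T : measurableType d) (k : nat) (V : T -> 'cV[R]_k) :
  random_vector V -> measurable_fun setT (fun x => enorm (V x)).
Proof.
move=> mV; apply: measurableT_comp.
  by apply: continuous_measurable_fun; exact: sqrt_continuous.
by apply: measurable_sum => i; apply: measurable_funX; exact: mV.
Qed.

Lemma random_vectorB (R : realType) (d : measure_display)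
    (T : measurableType d) (k : nat) (V W : T -> 'cV[R]_k) :
  random_vector V -> random_vector W -> random_vector (fun x => V x - W x).
Proof.
move=> mV mW i; under eq_fun do rewrite !mxE.
exact: measurable_funB (mV i) (mW i).
Qed.

Lemma random_vector_mulmx (R : realType) (d : measure_display)
    (T : measurableType d) (k l : nat) (M : 'M[R]_(l, k)) (V : T -> 'cV[R]_k) :
  random_vector V -> random_vector (fun x => M *m V x).
Proof.
move=> mV i; under eq_fun do rewrite mxE.
by apply: measurable_sum => j; apply: measurable_funM => //; exact: mV.
Qed.

Lemma random_vector_if (R : realType) (d : measure_display)
    (T : measurableType d) (k : nat) (b : T -> bool) (V W : T -> 'cV[R]_k) :
  measurable_fun setT b -> random_vector V -> random_vector W ->
  random_vector (fun x => if b x then V x else W x).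
Proof.
move=> mb mV mW i.
under eq_fun do rewrite (fun_if (fun v : 'cV[R]_k => v i 0)).
exact: measurable_fun_ifT mb (mV i) (mW i).
Qed.

Lemma pteE (R : realType) (p : nat) (d : nat -> measure_display)
    (X : forall n, measurableType (d n)) (phi : forall n, X n -> bool)
    (thetaU thetaC : forall n, X n -> 'cV[R]_p) (n : nat) (x : X n) :
  pte phi thetaU thetaC x = if phi n x then thetaU n x else thetaC n x.
Proof.
by rewrite /pte; case: (phi n x); rewrite scale1r scale0r ?addr0 ?add0r.
Qed.

(** A deviation of any size [eps > 0] forces the complement of the agreement
    event [E n], whose probability tends to zero. *)
Lemma eq_oP_of_eq_on {R : realType} {d : nat -> measure_display}
    {X : forall n, measurableType (d n)} {Q : forall n, probability (X n) R}
    {k : nat} {V W : forall n, X n -> 'cV[R]_k} (E : forall n, set (X n)) :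
  (forall n, random_vector (V n)) -> (forall n, random_vector (W n)) ->
  (forall n, measurable (E n)) ->
  (forall n x, E n x -> V n x = W n x) ->
  Q n (E n) @[n --> \oo] --> 1%E ->
  eq_oP Q V W.
Proof.
move=> mV mW mE VW QE eps eps0.
have QCE : Q n (~` E n) @[n --> \oo] --> 0%E.
  under eq_fun do rewrite probability_setC //.
  rewrite -(subee (x := 1%E)) //.
  by apply: cvgeB => //; exact: cvg_cst.
apply: squeeze_cvge QCE; last exact: cvg_cst.
near=> n; rewrite measure_ge0 /= le_measure ?inE //.
- have mN : measurable_fun setT (fun x => `|(enorm (V n x - W n x))%:E|%E).
    apply: measurableT_comp => //; apply/measurable_EFinP.
    exact/measurable_enorm/random_vectorB.
  by rewrite -[X in measurable X]setTI; exact: emeasurable_fun_c_infty.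
- exact: measurableC.
- move=> x /= devx Ex; move: devx.
  by rewrite VW // subrr enorm0 normr0 lee_fin leNgt eps0.
Unshelve. all: by end_near. Qed.

Theorem theorem1 (R : realType) (p r : nat) (hrp : (r < p)%N)
    (Theta : set 'cV[R]_p) (hTheta : open Theta)
    (Upsilon : 'M[R]_(p, r)) (hUpsilon : \rank Upsilon = r)
    (d : nat -> measure_display) (X : forall n, measurableType (d n))
    (P : forall n, 'cV[R]_p -> probability (X n) R)
    (thetaU thetaC : forall n, X n -> 'cV[R]_p)
    (hUmeas : forall n, random_vector (thetaU n))
    (hCmeas : forall n, random_vector (thetaC n))
    (hU : forall n x, Theta (thetaU n x))
    (hC : forall n x, constraint_set Upsilon Theta (thetaC n x))
    (phi : forall n, X n -> bool)
    (alpha : R) (halpha0 : 0 < alpha) (halpha1 : alpha < 1)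
    (nu : nat -> 'M[R]_p)
    (Delta : forall n, 'cV[R]_p -> X n -> 'cV[R]_p)
    (Gamma : 'cV[R]_p -> 'M[R]_p)
    (hA : ULAN Theta P nu Delta Gamma)
    (S : forall n, 'cV[R]_p -> X n -> 'cV[R]_p)
    (Sigma Omega A : 'cV[R]_p -> 'M[R]_p)
    (B : 'cV[R]_p -> 'M[R]_(r, p))
    (C : 'cV[R]_p -> 'M[R]_p)
    (D : forall n, X n -> 'cV[R]_p)
    (hB : estimators_and_test Theta Upsilon P nu Delta Gamma thetaU thetaC
            phi alpha S Sigma Omega A B C D)
    (theta : 'cV[R]_p)
    (htheta : (Theta `\` constraint_set Upsilon Theta) theta)
    (hOP : is_OP (fun n => P n theta) thetaC) :
  eq_oP (fun n => P n theta)
    (fun n x => invmx (nu n) *m (pte phi thetaU thetaC x - theta))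
    (fun n x => invmx (nu n) *m (thetaU n x - theta)).
Proof.
have mphi n : measurable_fun setT (phi n).
  have -> : phi n = (fun x => chi2_quantile (p - r) (1 - alpha)
                              < enorm (D n x) ^+ 2).
    by apply/funext => x; exact: et_test hB n x.
  apply: measurable_fun_ltr; first exact: measurable_cst.
  apply: measurable_funX; apply: measurable_enorm; exact: et_D_random hB n.
apply: (eq_oP_of_eq_on (fun n => [set x | phi n x])).
- move=> n; apply/random_vector_mulmx/random_vectorB => //.
  have -> : pte phi thetaU thetaC (n := n)
      = (fun x => if phi n x then thetaU n x else thetaC n x).
    by apply/funext => x; exact: pteE.
  exact: random_vector_if.
- move=> n; apply/random_vector_mulmx/random_vectorB => //.
- move=> n; rewrite -[X in measurable X]setTI.
  exact: (mphi n measurableT [set true]).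
- by move=> n x /= phix; rewrite pteE phix.
- under eq_fun => n do under eq_set => x do rewrite (et_test hB).
  exact: et_consistent hB theta htheta.
Qed.
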